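(* Let $n\ge1$, let $w=(w_1,\dots,w_n)\in\mathbb{R}^n$ with $\|w\|_2=1$, and let $t\ge1$. Define $$\mathcal{A}=\Bigl\{x\in\mathbb{R}^n:\sum_i x_iw_i>t\Bigr\},\qquad \mathcal{B}=\Bigl\{x\in\mathbb{R}^n:\sum_i x_iw_i>-t\Bigr\}.$$ Then $$\mathrm{Cov}_\gamma(\mathbf{1}_{\mathcal{A}},\mathbf{1}_{\mathcal{B}})\ \le\ \frac{2\,\mathcal{W}^{(\gamma)}_1(\mathcal{A},\mathcal{B})}{\sqrt{\log\frac{e}{\mathcal{W}^{(\gamma)}_1(\mathcal{A},\mathcal{A})}}\ \sqrt{\log\frac{e}{\mathcal{W}^{(\gamma)}_1(\mathcal{B},\mathcal{B})}}}.$$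
   Context: $\gamma$ is the standard Gaussian measure $N(0,I_n)$ on $\mathbb{R}^n$, and $\mathrm{Cov}_\gamma(u,v)=\mathbb{E}_\gamma[uv]-\mathbb{E}_\gamma[u]\,\mathbb{E}_\gamma[v]$. For a measurable set $\mathcal{A}\subset\mathbb{R}^n$, the Gaussian influence of the $k$-th coordinate is $I_k^{(\gamma)}(\mathcal{A})=\mathbb{E}_\gamma[\mathbf{1}_{\mathcal{A}}\,\mathbf{x}_k]$, where $\mathbf{x}_k(x)=x_k$ is the $k$-th coordinate function. For two such sets, $\mathcal{W}^{(\gamma)}_1(\mathcal{A},\mathcal{B})=\sum_{k=1}^n I_k^{(\gamma)}(\mathcal{A})\,I_k^{(\gamma)}(\mathcal{B})$. *)

(* Defs.v *)
(* The real numbers are an arbitrary R : realType of MathComp-Analysis. *)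
From HB Require Import structures.
From mathcomp Require Import all_boot all_order all_algebra.
From mathcomp Require Import all_classical all_reals all_analysis.

Set Implicit Arguments.
Unset Strict Implicit.
Unset Printing Implicit Defensive.

Import Order.TTheory GRing.Theory Num.Theory.
Import numFieldNormedType.Exports.

Local Open Scope classical_set_scope.
Local Open Scope ring_scope.

(* R^n as n-tuples: these carry the product (hence Borel) sigma-algebra,
   whereas row vectors have no measurable structure in the library. *)
Notation Rn R n := (n.-tuple (measurableTypeR R)).

Definition coordinate {R : realType} {n : nat} (k : 'I_n) (x : Rn R n) : R :=
  tnth x k.

Definition dotprod {R : realType} {n : nat} (x w : Rn R n) : R :=
  \sum_(i < n) coordinate i x * coordinate i w.

Definition l2norm {R : realType} {n : nat} (w : Rn R n) : R :=
  Num.sqrt (\sum_(i < n) coordinate i w ^+ 2).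

Definition Rn_cons (R : realType) (n : nat)
    (p : measurableTypeR R * Rn R n) : Rn R n.+1 :=
  [tuple of p.1 :: p.2].

Lemma measurable_Rn_cons (R : realType) (n : nat) :
  measurable_fun [set: measurableTypeR R * Rn R n] (@Rn_cons R n).
Proof. exact: measurable_cons. Qed.

HB.instance Definition _ (R : realType) (n : nat) :=
  isMeasurableFun.Build _ _ _ _ (@Rn_cons R n) (@measurable_Rn_cons R n).

(* N(0, I_n) is the n-fold product of N(0, 1), built by transporting
   N(0, 1) \x N(0, I_n) from R * R^n to R^(n+1). *)
Fixpoint gaussian (R : realType) (n : nat) : probability (Rn R n) R :=
  match n with
  | 0 => dirac ([tuple] : Rn R 0)
  | m.+1 => distribution (normal_prob (0 : R) 1 \x gaussian R m)%E
              (@Rn_cons R m)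
  end.

Lemma gaussian_box (R : realType) (n : nat) (A : 'I_n -> set (measurableTypeR R)) :
  (forall i, measurable (A i)) ->
  gaussian R n [set x | forall i, A i (coordinate i x)] =
  (\prod_(i < n) normal_prob (0:R) 1 (A i))%E.
Proof.
rewrite /coordinate.
elim: n A => [|n IH] A mA.
  rewrite big_ord0 /= diracE mem_set //=; by case.
rewrite big_ord_recl /= -(IH (fun i => A (lift ord0 i)))//.
rewrite /distribution /pushforward -product_measure1E//.
  congr (product_measure1 _ _ _); apply/seteqP; split => -[x y] /=.
    move=> h; split; first exact: (h ord0).
    by move=> i; have := h (lift ord0 i); rewrite tnthS.
  move=> [h0 h1] i; have [j ->|->//] := unliftP ord0 i.
  by rewrite tnthS; exact: h1.
rewrite (_ : [set _ | _] = \bigcap_(i in [set: 'I_n]) ((@tnth _ _)^~ i @^-1` A (lift ord0 i))).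
  apply: fin_bigcap_measurable => // i _; rewrite -[X in measurable X]setTI.
  exact: measurable_tnth.
by apply/seteqP; split => x /= h i; [move=> _|]; exact: h.
Qed.

(* 'E_P[X] is extended-real valued; fine loses nothing on the integrable
   functions considered here (indicators, indicators times a coordinate). *)
Definition mean {R : realType} {n : nat} (u : Rn R n -> R) : R :=
  fine 'E_(gaussian R n)[u].

Definition Cov {R : realType} {n : nat} (u v : Rn R n -> R) : R :=
  mean (fun x => u x * v x) - mean u * mean v.

Definition influence {R : realType} {n : nat} (k : 'I_n) (A : set (Rn R n)) : R :=
  mean (fun x => \1_A x * coordinate k x).

Definition W1 {R : realType} {n : nat} (A B : set (Rn R n)) : R :=
  \sum_(k < n) influence k A * influence k B.

(* Main.v *)
(* For |w| = 1 the functional <x, w> is standard normal under the Gaussian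
   measure, so with p the standard normal density the covariance is
   P(N > t) P(N >= t), the k-th influence of either half-space is w_k p(t), and
   all three weights W1 equal p(t)^2.  The claim becomes
   P(N >= t)^2 <= 2 p(t)^2 / (1 + t^2 + ln (2 pi)), which follows from the tail
   bound P(N >= t) <= (4/3) p(t) / (1 + t), ln (2 pi) <= 5/2 and t >= 1.
   Influences and half-space probabilities are computed by induction on the
   dimension, the step being that averaging the N(m + a x, s^2) density over a
   standard normal x gives the N(m, s^2 + a^2) density. *)
Require Import Defs.
From mathcomp Require Import all_boot all_order all_algebra.
From mathcomp Require Import all_classical all_reals all_analysis.
From mathcomp Require Import measurable_realfun ring lra.

Import Order.TTheory GRing.Theory Num.Theory.
Import numFieldNormedType.Exports.
Local Open Scope classical_set_scope.
Local Open Scope ring_scope.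

Local Notation mu := lebesgue_measure.
Local Notation N01 := (normal_prob 0 1).

(** * The standard normal distribution on the line *)

(** The density depends only on [(x - m) ^+ 2]. Exchanging point and mean turns measurability in the
    point into measurability in the mean. *)
Lemma normal_pdfC (R : realType) (m s x : R) : s != 0 ->
  normal_pdf m s x = normal_pdf x s m.
Proof.
by move=> s0; rewrite !normal_pdfE// /normal_fun -sqrrN opprB.
Qed.

Lemma normal_pdf_shift (R : realType) (m s x : R) : s != 0 ->
  normal_pdf m s x = normal_pdf 0 s (x - m).
Proof. by move=> s0; rewrite !normal_pdfE// /normal_fun subr0. Qed.

Lemma std_normal_pdfE (R : realType) (x : R) :
  normal_pdf 0 1 x = normal_peak 1 * expR (- x ^+ 2 / 2).
Proof.
by rewrite normal_pdfE ?oner_neq0// /normal_fun subr0 expr1n.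
Qed.

Lemma std_normal_pdfN (R : realType) (x : R) :
  normal_pdf 0 1 (- x) = normal_pdf 0 1 x.
Proof. by rewrite !std_normal_pdfE sqrrN. Qed.

(** Change of variables holds for the Radon-Nikodym derivative, and that derivative agrees almost
    everywhere with [normal_pdf] because both have the same integrals over measurable sets. *)
Lemma ge0_integral_normal_prob (R : realType) (m s : R)
    (f : measurableTypeR R -> \bar R) (D : set (measurableTypeR R)) :
  measurable D -> measurable_fun D f -> (forall x, 0 <= f x)%E ->
  (\int[normal_prob m s]_(x in D) f x =
   \int[mu]_(x in D) (f x * (normal_pdf m s x)%:E))%E.
Proof.
move=> mD mf f0.
have dom := @normal_prob_dominates R m s.
rewrite -(Radon_Nikodym_SigmaFinite.change_of_variables dom)//.
have mpdf (E : set (measurableTypeR R)) :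
    measurable_fun E (EFin \o normal_pdf m s).
  apply/measurable_EFinP; apply: measurable_funTS.
  exact: measurable_normal_pdf.
have int := Radon_Nikodym_SigmaFinite.f_integrable dom.
apply: ae_eq_integral => //.
- apply: emeasurable_funM => //; apply: (measurable_int mu).
  exact: integrableS int.
- exact: emeasurable_funM.
- apply: ae_eqe_mul2l; apply: integral_ae_eq => //.
  + exact: integrableS int.
  + by move=> E _ mE; rewrite -Radon_Nikodym_SigmaFinite.f_integral.
Qed.

(** The density is even and Lebesgue measure is invariant under reflection. *)
Lemma normal_probN (R : realType) (A : set (measurableTypeR R)) :
  measurable A -> @normal_prob R 0 1 (-%R @^-1` A) = normal_prob 0 1 A.
Proof.
move=> mA; have mN : measurable_fun [set: measurableTypeR R]
    (-%R : measurableTypeR R -> measurableTypeR R) by exact: oppr_measurable.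
rewrite /normal_prob.
under eq_integral do rewrite -std_normal_pdfN.
rewrite -(ge0_integral_pushforward mN mu mA (f := EFin \o normal_pdf 0 1))//=.
- by apply: eq_measure_integral => B mB _; exact: lebesgue_measureN.
- apply/measurable_EFinP; apply: measurable_funTS.
  exact: measurable_normal_pdf.
- by move=> x _; rewrite lee_fin normal_pdf_ge0.
Qed.

Lemma integral_normal_probN (R : realType) (f : measurableTypeR R -> \bar R) :
  measurable_fun [set: measurableTypeR R] f ->
  (@normal_prob R 0 1).-integrable [set: measurableTypeR R] (f \o -%R) ->
  (\int[N01]_x f x = \int[N01]_x f (- x)%R)%E.
Proof.
move=> mf intf.
have mN : measurable_fun [set: measurableTypeR R]
    (-%R : measurableTypeR R -> measurableTypeR R) by exact: oppr_measurable.
transitivity (\int[pushforward (@normal_prob R 0 1)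
    (-%R : measurableTypeR R -> measurableTypeR R)]_x f x)%E; last first.
  by rewrite integral_pushforward.
by apply: eq_measure_integral => A mA _; exact/esym/normal_probN.
Qed.

Global Instance is_derive_std_normal_pdf (R : realType) (x : R) :
  is_derive x 1 (normal_pdf 0 1) (- x * normal_pdf 0 1 x).
Proof.
have h : is_derive x 1 (fun y : R => - y ^+ 2 / 2) (- x).
  by apply: is_derive_eq; rewrite /GRing.scale/=; field.
have hc := @is_derive1_comp R expR _ x _ _ (is_derive_expR _) h.
rewrite std_normal_pdfE (_ : normal_pdf 0 1 = normal_peak 1 \*:
    (expR \o (fun y : R => - y ^+ 2 / 2))); last first.
  by apply/funext => y; rewrite std_normal_pdfE.
by apply: is_derive_eq; rewrite /GRing.scale/=; ring.
Qed.

Lemma cvg_std_normal_pdf (R : realType) :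
  normal_pdf (0 : R) 1 x @[x --> +oo%R] --> (0 : R).
Proof.
rewrite (_ : normal_pdf 0 1 =
    (fun y : R => normal_peak 1 * expR (- y ^+ 2 / 2))); last first.
  by apply/funext => y; rewrite std_normal_pdfE.
rewrite -[X in _ --> X](mulr0 (normal_peak 1)).
apply: cvgM; first exact: cvg_cst.
under eq_fun do rewrite mulNr.
apply: (cvg_comp (fun x : R => x ^+ 2 / 2) (fun x => expR (- x)));
  last exact: cvgr_expR.
by apply: gt0_cvgMly; [rewrite invr_gt0|exact: cvgr_expr2].
Qed.

Lemma continuous_std_normal_pdf (R : realType) :
  continuous (normal_pdf (0 : R) 1).
Proof. by apply: continuous_normal_pdf; exact: oner_neq0. Qed.

(** * Tails of the standard normal law *)

(** Since [p' = - x p], the function [- p] is a primitive of the integrand and vanishes at infinity.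
    The sign of [d] makes the integrand nonnegative. *)
Lemma integral_std_normal_pdf_tail (R : realType) (d : R) : 0 <= d ->
  (\int[mu]_(x in `[d, +oo[) (x * normal_pdf 0 1 x)%:E =
   (normal_pdf 0 1 d)%:E)%E.
Proof.
move=> d0; pose F := (fun x : R => - normal_pdf 0 1 x).
have dF (x : R) : is_derive x 1 F (x * normal_pdf 0 1 x).
  by apply: is_derive_eq; rewrite mulNr opprK.
rewrite (@ge0_continuous_FTC2y R _ F _ 0) /F -?EFinB ?sub0r ?opprK//.
- by move=> x dx; rewrite mulr_ge0 ?normal_pdf_ge0// (le_trans d0).
- apply: continuous_subspaceT => x.
  by apply: cvgM; [exact: cvg_id|exact: continuous_std_normal_pdf].
- by rewrite -[X in _ --> X]oppr0; apply: cvgN; exact: cvg_std_normal_pdf.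
- apply: cvg_at_right_filter; apply: cvgN; exact: continuous_std_normal_pdf.
- by move=> x _; rewrite derive1E; exact: derive_val.
Qed.

(* [- d/dx (4/3 pdf x / (1 + x)) = 4/3 pdf x (x^2 + x + 1) / (1 + x)^2], and
   [4 (x^2 + x + 1) - 3 (1 + x)^2 = (x - 1)^2]. *)
Lemma normal_prob_tail_le (R : realType) (d : R) : 0 <= d ->
  (normal_prob 0 1 `[d, +oo[ <= (4 / 3 * (normal_pdf 0 1 d / (1 + d)))%:E)%E.
Proof.
move=> d0; pose F := (fun x : R => - (4 / 3 * (normal_pdf 0 1 x / (1 + x)))).
pose f (x : R) :=
  4 / 3 * (normal_pdf 0 1 x * ((x ^+ 2 + x + 1) / (1 + x) ^+ 2)).
have x1 (x : R) : d <= x -> 1 + x != 0.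
  by move=> dx; rewrite gt_eqF// ltr_pwDl// (le_trans d0).
have dF (x : R) : d <= x -> is_derive x 1 F (f x).
  move=> dx; have nx := x1 _ dx.
  have h : is_derive x 1 (fun y : R => (1 + y)^-1) (- (1 + x) ^- 2).
    apply: is_derive_eq.
    by rewrite /GRing.scale/= add0r mulr1.
  apply: is_derive_eq; rewrite /GRing.scale/= /f.
  by field.
have ndpdf (x : R) : d <= x -> normal_pdf 0 1 x <= f x.
  move=> dx; rewrite /f mulrCA ler_peMr ?normal_pdf_ge0//.
  have x10 : 0 < (1 + x) ^+ 2 by rewrite exprn_gt0// ltr_pwDl// (le_trans d0).
  rewrite mulrA ler_pdivlMr// mul1r.
  have := sqr_ge0 (x - 1); lra.
have cf (x : R) : d <= x -> {for x, continuous f}.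
  move=> dx; apply: cvgM; first exact: cvg_cst.
  apply: cvgM; first exact: continuous_std_normal_pdf.
  apply: cvgM.
    by apply: cvgD; [apply: cvgD; [exact: exprn_continuous|exact: cvg_id]
      |exact: cvg_cst].
  apply: cvgV; first by rewrite expf_neq0// x1.
  by apply: cvgM; apply: cvgD; (exact: cvg_cst || exact: cvg_id).
have cfd : {within `[d, +oo[, continuous f}.
  apply: continuous_in_subspaceT => x; rewrite inE/= in_itv/= andbT => dx.
  exact: cf.
(* The density is dominated by [f], the derivative of [F]; as [F] tends to 0 at infinity, the
   integral of [f] is [- F d]. *)
apply: (@le_trans _ _ (\int[mu]_(x in `[d, +oo[) (f x)%:E)%E).
  apply: ge0_le_integral => //=.
  - by move=> x _; rewrite lee_fin normal_pdf_ge0.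
  - apply/measurable_EFinP; apply: measurable_funTS.
    exact: measurable_normal_pdf.
  - apply/measurable_EFinP.
    exact: (@subspace_continuous_measurable_fun _ `[d, +oo[ f).
  - by move=> x; rewrite /= in_itv/= andbT lee_fin => /ndpdf.
rewrite (@ge0_continuous_FTC2y R f F d 0).
- by rewrite -EFinB sub0r opprK.
- by move=> x /ndpdf; apply: le_trans; exact: normal_pdf_ge0.
- exact: cfd.
- have -> : 0 = - (4 / 3 * (0 * 0)) :> R by rewrite mul0r mulr0 oppr0.
  apply: cvgN; apply: cvgM; first exact: cvg_cst.
  apply: cvgM; first exact: cvg_std_normal_pdf.
  apply/gtr0_cvgV0; last exact: cvg_addrl.
  by near=> x; rewrite ltr_pwDl//; near: x; exact: nbhs_pinfty_ge.
- by move=> x /ltW /dF[].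
- apply: cvg_at_right_filter; apply: cvgN; apply: cvgM; first exact: cvg_cst.
  apply: cvgM; first exact: continuous_std_normal_pdf.
  apply: cvgV; first exact: x1.
  by apply: cvgD; [exact: cvg_cst|exact: cvg_id].
- move=> x; rewrite in_itv/= andbT => /ltW /dF dFx.
  by rewrite derive1E; exact: derive_val.
Unshelve. all: by end_near. Qed.

(** * Indicators, integrability and rescaling *)

Lemma indic_predE (T : Type) (R : pzRingType) (p : T -> bool) (x : T) :
  \1_[set y | p y] x = (p x)%:R :> R.
Proof.
by rewrite indicE (_ : (x \in _) = p x)//; apply/idP/idP; rewrite inE.
Qed.

Lemma measurable_gt_set d (T : measurableType d) (R : realType) (f : T -> R)
    (t : R) :
  measurable_fun [set: T] f -> measurable [set x | t < f x].
Proof.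
move=> mf; rewrite (_ : [set x | _] = f @^-1` `]t, +oo[).
  by rewrite -[X in measurable X]setTI; exact: mf.
by apply/seteqP; split => x /=; rewrite in_itv/= andbT.
Qed.

Lemma integrable_indicM d (T : measurableType d) (R : realType)
    (P : {measure set T -> \bar R}) (A : set T) (f : T -> R) :
  measurable A -> P.-integrable [set: T] (EFin \o f) ->
  P.-integrable [set: T] (fun x => (\1_A x * f x)%:E).
Proof.
move=> mA intf; apply: (le_integrable measurableT _ _ intf).
  apply/measurable_EFinP; apply: measurable_funM => //.
  by apply/measurable_EFinP; exact: measurable_int intf.
move=> x _ /=; rewrite lee_fin normrM indicE.
by case: (x \in A); rewrite ?normr1 ?mul1r// normr0 mul0r.
Qed.

Lemma normal_peak_scale (R : realType) (s : R) : 0 < s ->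
  normal_peak s = normal_peak 1 / s.
Proof.
move=> s0; rewrite /normal_peak expr1n mul1r -mulrnAr sqrtrM ?sqr_ge0//.
by rewrite sqrtr_sqr gtr0_norm// invfM mulrC.
Qed.

Lemma normal_pdf_scale (R : realType) (m s x : R) : 0 < s ->
  s * normal_pdf m s x = normal_pdf 0 1 ((x - m) / s).
Proof.
move=> s0; rewrite std_normal_pdfE normal_pdfE ?gt_eqF// mulrA.
congr (_ * _).
  by rewrite normal_peak_scale// mulrCA divff ?mulr1// gt_eqF.
rewrite /normal_fun; congr expR.
by field; rewrite gt_eqF.
Qed.

(** * First moments of the standard normal law *)

(** By symmetry the first absolute moment is twice the integral over the positive half-line, which
    is the tail integral from 0. *)
Lemma integrable_normal_prob_id (R : realType) :
  (@normal_prob R 0 1).-integrable [set: measurableTypeR R] EFin.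
Proof.
apply/integrableP; split => //.
rewrite ge0_integral_normal_prob//; last exact: measurableT_comp.
rewrite (eq_integral (fun x : measurableTypeR R =>
  (`|x| * normal_pdf 0 1 x)%:E))//.
rewrite ge0_symfun_integralT.
- rewrite -set_itvcy (eq_integral (fun x : measurableTypeR R =>
      (x * normal_pdf 0 1 x)%:E)).
    by rewrite integral_std_normal_pdf_tail// -EFinM ltry.
  by move=> x; rewrite inE/= in_itv/= andbT => x0; rewrite ger0_norm.
- by move=> x; rewrite mulr_ge0// normal_pdf_ge0.
- move=> x; apply: cvgM; last exact: continuous_std_normal_pdf.
  exact: norm_continuous.
- by move=> x /=; rewrite normrN std_normal_pdfN.
Qed.

(** Reflection shows that the integral equals its own opposite; integrability makes it finite, hence
    zero. *)
Lemma integral_normal_prob_id (R : realType) :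
  (\int[@normal_prob R 0 1]_x x%:E = 0)%E.
Proof.
have i := integrable_normal_prob_id R.
have iN : (@normal_prob R 0 1).-integrable [set: measurableTypeR R]
    (EFin \o -%R) by exact: integrableN i.
have fin := integrable_fin_num measurableT i.
have := @integral_normal_probN R EFin (measurable_int _ i) iN.
rewrite (integralN (integrable_add_def measurableT i)).
move: fin; case: (integral _ _ _) => //= r _ [].
by move=> rr; congr EFin; lra.
Qed.

(** The flag [b] selects the closed ([true]) or open ([false]) half-line: reflecting a strict
    inequality and taking complements produces both. *)
Lemma integral_normal_prob_tail_ge0 (R : realType) (b : bool) (c : R) :
  0 <= c ->
  (\int[N01]_x (\1_[set` Interval (BSide b c) +oo%O] x * x)%:E =
   (normal_pdf 0 1 c)%:E)%E.
Proof.
move=> c0; rewrite ge0_integral_normal_prob//=.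
- transitivity (\int[mu]_(x in [set` Interval (BSide b c) +oo%O])
      (x * normal_pdf 0 1 x)%:E)%E.
    rewrite [RHS]integral_mkcond; apply: eq_integral => x _.
    by rewrite epatch_indic/= -!EFinM; congr EFin; ring.
  rewrite -integral_std_normal_pdf_tail//; case: b => //.
  apply: integral_itv_obnd_cbnd; apply/measurable_EFinP.
  apply: measurable_funM => //; apply: measurable_funTS.
  exact: measurable_normal_pdf.
- by apply/measurable_EFinP; exact: measurable_funM.
- move=> x; rewrite lee_fin indicE.
  have [|_] := boolP (x \in _); last by rewrite mul0r.
  rewrite inE/= in_itv/= andbT mul1r.
  by case: b => /= [|/ltW]; exact: le_trans.
Qed.

Lemma integral_normal_prob_tail (R : realType) (c : R) :
  (\int[@normal_prob R 0 1]_x (\1_[set x | c < x] x * x)%:E =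
   (normal_pdf 0 1 c)%:E)%E.
Proof.
have i := integrable_normal_prob_id R.
have setE b (a : R) : [set` Interval (BSide b a) +oo%O] =
    if b then [set x | a <= x] else [set x | a < x].
  by apply/seteqP; split => x /=; case: b; rewrite in_itv/= andbT.
have [c0|c0] := leP 0 c.
  by rewrite -(integral_normal_prob_tail_ge0 _ false)// setE.
have mle (a : R) : measurable ([set x | x <= a] : set (measurableTypeR R)).
  by rewrite -set_itvNyc.
(* For [c < 0] the mean over [c < x] is minus that over [x <= c], hence by
   symmetry the mean over [- c <= x]. *)
rewrite -std_normal_pdfN -(integral_normal_prob_tail_ge0 _ true) ?setE//;
  last by rewrite oppr_ge0 ltW.
transitivity (\int[@normal_prob R 0 1]_x
    (x%:E - (\1_[set x | x <= c] x * x)%:E))%E.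
  apply: eq_integral => x _; rewrite -EFinB !indic_predE; congr EFin.
  by case: leP => _; rewrite ?mul1r ?mul0r ?subrr ?subr0.
rewrite integralB//; last exact: integrable_indicM.
have intN : (@normal_prob R 0 1).-integrable [set: measurableTypeR R]
    ((fun x => (\1_[set x | x <= c] x * x)%:E) \o -%R).
  rewrite (_ : _ \o _ = fun x : measurableTypeR R =>
      (\1_[set x | - c <= x] x * - x)%:E); last first.
    by apply/funext => x /=; rewrite !indic_predE lerNl.
  apply: integrable_indicM; last exact: integrableN i.
  by rewrite -set_itvcy.
rewrite integral_normal_prob_id [in LHS]integral_normal_probN//; last first.
  by apply/measurable_EFinP; exact: measurable_funM.
rewrite sub0e -(integralN (integrable_add_def measurableT intN)).
apply: eq_integral => x _; rewrite -EFinN; congr EFin.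
by rewrite !indic_predE mulrN opprK lerNl.
Qed.

(** This is the influence of one coordinate while the others are frozen in [m]. Rescaling treats
    [w > 0] and reflection [w < 0]; for [w = 0] the indicator is constant and both sides vanish,
    whatever the density of deviation 0 is. *)
Lemma integral_normal_prob_halfline (R : realType) (m w t : R) :
  (\int[@normal_prob R 0 1]_x (\1_[set x | t < m + x * w] x * x)%:E =
   (w * normal_pdf m `|w| t)%:E)%E.
Proof.
have i := integrable_normal_prob_id R.
have pos (s : R) : 0 < s ->
    (\int[@normal_prob R 0 1]_x (\1_[set x | t < m + x * s] x * x)%:E =
    (s * normal_pdf m `|s| t)%:E)%E.
  move=> s0; rewrite gtr0_norm// normal_pdf_scale// -integral_normal_prob_tail.
  apply: eq_integral => x _; rewrite !indic_predE.
  by rewrite ltr_pdivrMr// ltrBlDl.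
have [w0|w0|->] := ltgtP w 0; last 1 first.
- rewrite mul0r.
  rewrite (eq_integral (fun x : measurableTypeR R =>
    ((t < m)%R%:R)%:E * x%:E)%E); last first.
    by move=> x _; rewrite indic_predE mulr0 addr0 EFinM.
  by rewrite integralZl// integral_normal_prob_id mule0.
- have mw (s : R) : measurable ([set x | t < m + x * s] :
      set (measurableTypeR R)).
    by apply: measurable_gt_set; apply: measurable_funD => //;
      exact: measurable_funM.
  have intN : (@normal_prob R 0 1).-integrable [set: measurableTypeR R]
      ((fun x => (\1_[set x | t < m + x * w] x * x)%:E) \o -%R).
    rewrite (_ : _ \o _ = fun x : measurableTypeR R =>
        (\1_[set x | t < m + x * - w] x * - x)%:E); last first.
      by apply/funext => x /=; rewrite !indic_predE mulNr (mulrN x).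
    by apply: integrable_indicM => //; exact: integrableN i.
  rewrite integral_normal_probN//; last first.
    by apply/measurable_EFinP; exact: measurable_funM.
  have := pos (- w); rewrite oppr_gt0 normrN => /(_ w0) posN.
  rewrite -[RHS]oppeK -EFinN -mulNr EFinN -posN.
  rewrite -(integralN (integrable_add_def measurableT
    (integrable_indicM _ _ _ _ _ _ (mw _) i))).
  apply: eq_integral => x _; rewrite -EFinN; congr EFin.
  by rewrite !indic_predE mulNr (mulrN x) mulrN.
- exact: pos.
Qed.

(** * Affine images and mixtures of normal laws *)

(** For a positive slope this is the substitution [u = m + x * s] in the density integral; a
    negative slope is reduced to it by reflection. *)
Lemma normal_prob_affine_tail (R : realType) (m w t : R) : w != 0 ->
  @normal_prob R 0 1 [set x | t < m + x * w] = normal_prob m `|w| `]t, +oo[.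
Proof.
have pos (s : R) : 0 < s ->
    @normal_prob R 0 1 [set x | t < m + x * s] = normal_prob m s `]t, +oo[.
  move=> s0; have sn0 : s != 0 by rewrite gt_eqF.
  pose c := (t - m) / s; pose F (x : R) := m + x * s.
  have tE : t = F c by rewrite /F /c divfK// subrKC.
  have dF (x : R) : is_derive x 1 F s.
    by apply: is_derive_eq; rewrite /GRing.scale/=; ring.
  have F'E : F^`()%classic = cst s.
    by apply/funext => x; rewrite derive1E derive_val.
  have cF : continuous F.
    by move=> x; apply: differentiable_continuous; apply/derivable1_diffP.
  have -> : [set x | t < m + x * s] = `]c, +oo[%classic.
    apply/seteqP; split => x /=;
    by rewrite in_itv/= andbT /c ltr_pdivrMr// ltrBlDl.
  (* Endpoints are null, so both half-lines are closed before substituting. *)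
  rewrite /normal_prob integral_itv_obnd_cbnd; last first.
    apply/measurable_EFinP; apply: measurable_funTS.
    exact: measurable_normal_pdf.
  rewrite integral_itv_obnd_cbnd; last first.
    apply/measurable_EFinP; apply: measurable_funTS.
    exact: measurable_normal_pdf.
  rewrite tE [RHS](@increasing_ge0_integration_by_substitutiony R F _ c).
  - apply: eq_integral => x _; rewrite F'E /=; congr EFin.
    transitivity (s * normal_pdf m s (F x)); last by rewrite mulrC.
    by rewrite normal_pdf_scale// /F addrAC subrr add0r mulfK.
  - by move=> x y _ _ xy; rewrite /F ltrD2l ltr_pM2r.
  - by rewrite F'E => x _; exact: cvg_cst.
  - by rewrite F'E; exact: is_cvg_cst.
  - by rewrite F'E; exact: is_cvg_cst.
  - split; first by move=> x _; case: (dF x).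
    by apply: cvg_at_right_filter; exact: cF.
  - apply: (cvg_comp (fun x : R => x * s) (fun x => m + x)).
      by apply: gt0_cvgMly => //; exact: cvg_id.
    exact: cvg_addrl.
  - apply: continuous_subspaceT; exact: continuous_normal_pdf.
  - by move=> x _; rewrite normal_pdf_ge0.
rewrite neq_lt => /orP[w0|w0].
- rewrite (ltr0_norm w0) -(pos (- w)); last by rewrite oppr_gt0.
  rewrite -normal_probN.
    congr (normal_prob 0 1 _); apply/seteqP.
    by split => x /=; rewrite mulNr mulrN.
  by apply: measurable_gt_set; apply: measurable_funD => //;
      exact: measurable_funM.
- by rewrite (gtr0_norm w0); exact: pos.
Qed.

(* Conditionally on [u], where [(x, u)] is Gaussian with [u = m + a x + s z],
   the variable [x] is again Gaussian. *)
Lemma mul_normal_pdf (R : realType) (m a s u x : R) : 0 < s ->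
  let c := Num.sqrt (s ^+ 2 + a ^+ 2) in
  normal_pdf 0 1 x * normal_pdf (m + x * a) s u =
  normal_pdf m c u * normal_pdf (a * (u - m) / c ^+ 2) (s / c) x.
Proof.
move=> s0 c; have s20 : 0 < s ^+ 2 by rewrite exprn_gt0.
have sa0 : 0 < s ^+ 2 + a ^+ 2 by rewrite ltr_pwDl// sqr_ge0.
have c0 : 0 < c by rewrite sqrtr_gt0.
have c2 : c ^+ 2 = s ^+ 2 + a ^+ 2 by rewrite sqr_sqrtr// ltW.
have sc0 : 0 < s / c by rewrite divr_gt0.
rewrite std_normal_pdfE !normal_pdfE ?gt_eqF//.
rewrite (normal_peak_scale _ s)// (normal_peak_scale _ c)//.
rewrite (normal_peak_scale _ (s / c))// /normal_fun.
(* The peaks match because [1 / s = (1 / c) * (c / s)], the exponents by completing the square in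
   [x]. *)
rewrite mulrACA [RHS]mulrACA -!expRD; congr (_ * expR _).
  by field; rewrite !gt_eqF.
rewrite expr_div_n c2; field.
by rewrite !gt_eqF.
Qed.

(** In the factorization of [mul_normal_pdf] only the conditional density depends on [x], and it
    integrates to 1. *)
Lemma integral_normal_pdf_affine (R : realType) (m a s u : R) : 0 < s ->
  (\int[@normal_prob R 0 1]_x (normal_pdf (m + x * a) s u)%:E =
   (normal_pdf m (Num.sqrt (s ^+ 2 + a ^+ 2)) u)%:E)%E.
Proof.
move=> s0; have sn0 : s != 0 by rewrite gt_eqF.
rewrite ge0_integral_normal_prob//; first last.
- by move=> x; rewrite lee_fin normal_pdf_ge0.
- apply/measurable_EFinP; under eq_fun do rewrite normal_pdfC//.
  apply: measurableT_comp; first exact: measurable_normal_pdf.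
  by apply: measurable_funD => //; exact: measurable_funM.
under eq_integral => x _.
  rewrite muleC -EFinM mul_normal_pdf// EFinM.
  over.
rewrite ge0_integralZl// ?lee_fin ?normal_pdf_ge0//.
- by rewrite integral_normal_pdf mule1.
- by apply/measurable_EFinP; exact: measurable_normal_pdf.
- by move=> x _; rewrite lee_fin normal_pdf_ge0.
Qed.

(** * The Gaussian measure on R^n *)

Lemma integral_probability_cst d (T : measurableType d) (R : realType)
    (P : probability T R) (r : \bar R) :
  (\int[P]_x r = r)%E.
Proof. by rewrite integral_cst//= probability_setT mule1. Qed.

Lemma ge0_integral_gaussianS (R : realType) (n : nat)
    (f : Rn R n.+1 -> \bar R) :
  measurable_fun [set: Rn R n.+1] f -> (forall x, 0 <= f x)%E ->
  (\int[gaussian R n.+1]_x f x =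
   \int[@normal_prob R 0 1]_x \int[gaussian R n]_y f (Rn_cons (x, y)))%E.
Proof.
move=> mf f0; rewrite ge0_integral_distribution// fubini_tonelli1//.
  exact: measurableT_comp.
by move=> x; exact: f0.
Qed.

Lemma integrable_gaussianS (R : realType) (n : nat) (f : Rn R n.+1 -> \bar R) :
  (gaussian R n.+1).-integrable [set: Rn R n.+1] f ->
  (normal_prob (0 : R) 1 \x gaussian R n)%E.-integrable
    [set: measurableTypeR R * Rn R n] (f \o @Rn_cons R n).
Proof.
move=> /integrableP[mf lt]; apply/integrableP; split.
  exact: measurableT_comp.
move: lt; rewrite ge0_integral_distribution//; exact: measurableT_comp.
Qed.

Lemma integral_gaussianS (R : realType) (n : nat) (f : Rn R n.+1 -> \bar R) :
  (gaussian R n.+1).-integrable [set: Rn R n.+1] f ->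
  (\int[gaussian R n.+1]_x f x =
   \int[@normal_prob R 0 1]_x \int[gaussian R n]_y f (Rn_cons (x, y)))%E.
Proof.
move=> intf; have intfc := integrable_gaussianS _ _ _ intf.
rewrite integral_distribution//; last exact: measurable_int intf.
by rewrite -integral12_prod_meas1.
Qed.

(** With the head coordinate innermost, its own influence becomes a one-dimensional integral. *)
Lemma integral_gaussianS_swap (R : realType) (n : nat)
    (f : Rn R n.+1 -> \bar R) :
  (gaussian R n.+1).-integrable [set: Rn R n.+1] f ->
  (\int[gaussian R n.+1]_x f x =
   \int[gaussian R n]_y \int[@normal_prob R 0 1]_x f (Rn_cons (x, y)))%E.
Proof.
move=> intf; have intfc := integrable_gaussianS _ _ _ intf.
rewrite integral_distribution//; last exact: measurable_int intf.
by rewrite -integral21_prod_meas1.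
Qed.

Lemma coordinate_cons0 (R : realType) (n : nat) (x : R) (y : Rn R n) :
  coordinate ord0 (Rn_cons (x, y)) = x.
Proof. by []. Qed.

Lemma coordinate_consS (R : realType) (n : nat) (j : 'I_n) (x : R)
    (y : Rn R n) :
  coordinate (lift ord0 j) (Rn_cons (x, y)) = coordinate j y.
Proof. by rewrite /coordinate tnthS. Qed.

Lemma dotprod_cons (R : realType) (n : nat) (x a : R) (y w : Rn R n) :
  dotprod (Rn_cons (x, y)) (Rn_cons (a, w)) = x * a + dotprod y w.
Proof.
rewrite /dotprod big_ord_recl; congr (_ + _).
by apply: eq_bigr => i _; rewrite !coordinate_consS.
Qed.

Lemma l2norm_cons (R : realType) (n : nat) (a : R) (w : Rn R n) :
  l2norm (Rn_cons (a, w)) = Num.sqrt (a ^+ 2 + l2norm w ^+ 2).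
Proof.
rewrite /l2norm sqr_sqrtr; last by apply: sumr_ge0 => i _; exact: sqr_ge0.
rewrite big_ord_recl; congr (Num.sqrt (_ + _)).
by apply: eq_bigr => i _; rewrite coordinate_consS.
Qed.

Lemma Rn_consP (R : realType) (n : nat) (x : Rn R n.+1) :
  exists p, x = Rn_cons p.
Proof.
by exists (thead x, [tuple of behead x]); exact: tuple_eta.
Qed.

Lemma measurable_coordinate (R : realType) (n : nat) (k : 'I_n) :
  measurable_fun [set: Rn R n] (coordinate k).
Proof. exact: measurable_tnth. Qed.

Lemma measurable_dotprod (R : realType) (n : nat) (w : Rn R n) :
  measurable_fun [set: Rn R n] (dotprod ^~ w).
Proof.
apply: measurable_sum => i; apply: measurable_funM => //.
exact: measurable_coordinate.
Qed.

Lemma measurable_halfspace (R : realType) (n : nat) (m t : R) (w : Rn R n) :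
  measurable [set x : Rn R n | t < m + dotprod x w].
Proof.
apply: measurable_gt_set; apply: measurable_funD => //.
exact: measurable_dotprod.
Qed.

(** Tonelli integrates out all other coordinates, leaving the first absolute moment of N(0, 1). *)
Lemma integrable_coordinate (R : realType) (n : nat) (k : 'I_n) :
  (gaussian R n).-integrable [set: Rn R n] (EFin \o coordinate k).
Proof.
have mabs m (j : 'I_m) : measurable_fun [set: Rn R m]
    (fun x => (`|coordinate j x|)%:E).
  apply/measurable_EFinP; apply: measurableT_comp => //.
  exact: measurable_coordinate.
apply/integrableP; split.
  by apply/measurable_EFinP; exact: measurable_coordinate.
elim: n k => [[]//|n IH] k.
rewrite ge0_integral_gaussianS//; last exact: mabs.
have [j ->|->] := unliftP ord0 k.
  under eq_integral do under eq_integral do rewrite /= coordinate_consS.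
  by rewrite integral_probability_cst; exact: IH.
under eq_integral => x _.
  under eq_integral do rewrite /= coordinate_cons0.
  rewrite integral_probability_cst.
  over.
by have /integrableP[] := integrable_normal_prob_id R.
Qed.

(** Variances add one coordinate at a time: the tail [v] raises [s ^+ 2] by its squared norm, then
    the head raises it by [a ^+ 2]. Keeping [m] and [s] general lets the induction absorb the head
    into the mean. *)
Lemma integral_gaussian_normal_pdf (R : realType) (n : nat) (m s u : R)
    (w : Rn R n) : 0 < s ->
  (\int[gaussian R n]_x (normal_pdf (m + dotprod x w) s u)%:E =
   (normal_pdf m (Num.sqrt (s ^+ 2 + l2norm w ^+ 2)) u)%:E)%E.
Proof.
have mpdf k (v : Rn R k) (l r : R) : 0 < r -> measurable_fun [set: Rn R k]
    (fun x => (normal_pdf (l + dotprod x v) r u)%:E).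
  move=> r0; apply/measurable_EFinP.
  under eq_fun do rewrite normal_pdfC ?gt_eqF//.
  apply: measurableT_comp; first exact: measurable_normal_pdf.
  by apply: measurable_funD => //; exact: measurable_dotprod.
elim: n m s w => [|n IH] m s w s0.
  rewrite /= integral_dirac//; last exact: mpdf.
  rewrite diracE mem_set// mul1e /l2norm /dotprod !big_ord0.
  by rewrite addr0 sqrtr0 expr0n addr0 sqrtr_sqr gtr0_norm.
rewrite ge0_integral_gaussianS//; first last.
- by move=> x; rewrite lee_fin normal_pdf_ge0.
- exact: mpdf.
have [[a v] ->] := Rn_consP _ _ w.
under eq_integral => x _.
  under eq_integral do rewrite dotprod_cons addrA.
  rewrite IH//.
  over.
rewrite integral_normal_pdf_affine; last first.
  by rewrite sqrtr_gt0 ltr_pwDl ?sqr_ge0// exprn_gt0.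
have sqr_sqrtD x y : Num.sqrt (x ^+ 2 + y ^+ 2) ^+ 2 = x ^+ 2 + y ^+ 2 :> R.
  by rewrite sqr_sqrtr// addr_ge0 ?sqr_ge0.
by rewrite l2norm_cons !sqr_sqrtD -addrA (addrC (l2norm v ^+ 2)).
Qed.

(** Tonelli moves the average over [x] inside the density integral, where
    [integral_normal_pdf_affine] applies pointwise in [u]. *)
Lemma integral_normal_prob_affine (R : realType) (m a s : R)
    (D : set (measurableTypeR R)) : 0 < s -> measurable D ->
  (\int[@normal_prob R 0 1]_x normal_prob (m + x * a) s D =
   normal_prob m (Num.sqrt (s ^+ 2 + a ^+ 2)) D)%E.
Proof.
move=> s0 mD; have sn0 : s != 0 by rewrite gt_eqF.
have probE l r : @normal_prob R l r D =
    (\int[mu]_u (\1_D u * normal_pdf l r u)%:E)%E.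
  rewrite /normal_prob integral_mkcond; apply: eq_integral => u _.
  by rewrite epatch_indic/= -EFinM mulrC.
rewrite probE; under eq_integral do rewrite probE.
pose f (p : measurableTypeR R * measurableTypeR R) :=
  (\1_D p.2 * normal_pdf (m + p.1 * a) s p.2)%:E.
rewrite (@fubini_tonelli _ _ _ _ _ _ _ f)/=; first last.
- by move=> p; rewrite lee_fin mulr_ge0// normal_pdf_ge0.
- apply/measurable_EFinP; apply: measurable_funM.
    by apply: measurableT_comp => //; exact: measurable_indic.
  (* As a function of the difference between point and mean, the density is jointly measurable in
     the pair. *)
  under eq_fun do rewrite normal_pdf_shift//.
  apply: measurableT_comp; first exact: measurable_normal_pdf.
  apply: measurable_funB => //; apply: measurable_funD => //.
  exact: measurable_funM.
apply: eq_integral => u _; rewrite /f/=.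
under eq_integral do rewrite EFinM.
rewrite ge0_integralZl// ?lee_fin//.
- by rewrite integral_normal_pdf_affine.
- apply/measurable_EFinP; under eq_fun do rewrite normal_pdfC//.
  apply: measurableT_comp; first exact: measurable_normal_pdf.
  by apply: measurable_funD => //; exact: measurable_funM.
- by move=> x _; rewrite lee_fin normal_pdf_ge0.
Qed.

(** * Measure and influences of half-spaces *)

Lemma l2norm_eq0 (R : realType) (n : nat) (w : Rn R n) (k : 'I_n) :
  l2norm w = 0 -> coordinate k w = 0.
Proof.
move/eqP; rewrite sqrtr_eq0 => w0; apply/eqP; rewrite -sqrf_eq0.
rewrite eq_le sqr_ge0 andbT; apply: le_trans w0.
by rewrite (bigD1 k)//= lerDl sumr_ge0// => i _; exact: sqr_ge0.
Qed.

(** Induction on the dimension: once the head is fixed, its contribution [x * a] joins the mean,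
    which is why [m] is arbitrary. *)
Lemma gaussian_halfspace (R : realType) (n : nat) (m t : R) (w : Rn R n) :
  l2norm w != 0 ->
  gaussian R n [set x | t < m + dotprod x w] =
  normal_prob m (l2norm w) `]t, +oo[.
Proof.
elim: n m w => [m w|n IH m w]; first by rewrite /l2norm big_ord0 sqrtr0 eqxx.
have [[a v] ->] := Rn_consP _ _ w; rewrite l2norm_cons => w0.
(* A product measure is by definition the integral of the measures of the sections. *)
transitivity (\int[@normal_prob R 0 1]_x
    gaussian R n [set y | (t < (m + x * a) + dotprod y v)%R])%E.
  apply: eq_integral => x _; rewrite /=; congr (gaussian R n _).
  apply/seteqP; split => y; rewrite /xsection/= inE/= dotprod_cons addrA//.
(* If the tail of the vector vanishes, the induction hypothesis does not apply; membership then
   depends on the head alone, and each section is everything or empty. *)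
have [v0|v0] := eqVneq (l2norm v) 0.
  have a0 : a != 0.
    by move: w0; rewrite v0 expr0n addr0 sqrtr_sqr normr_eq0.
  rewrite v0 expr0n addr0 sqrtr_sqr -normal_prob_affine_tail//.
  rewrite -[RHS]mul1e -integral_cst//; last first.
    by apply: measurable_gt_set; apply: measurable_funD => //;
      exact: measurable_funM.
  rewrite integral_mkcond; apply: eq_integral => x _.
  rewrite epatch_indic /= mul1e indic_predE.
  have dv0 y : dotprod y v = 0.
    by rewrite /dotprod big1// => i _; rewrite (l2norm_eq0 _ _ v)// mulr0.
  under eq_set do rewrite dv0 addr0.
  case: ltP => _.
    by rewrite (_ : [set _ | _] = setT) ?probability_setT//; apply/seteqP.
  by rewrite (_ : [set _ | _] = set0) ?measure0//; apply/seteqP; split.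
have v1 : 0 < l2norm v by rewrite lt_neqAle eq_sym v0 sqrtr_ge0.
under eq_integral do rewrite (IH _ _ v0).
rewrite (integral_normal_prob_affine _ _ _ _ _ v1); last exact: measurable_itv.
by rewrite addrC.
Qed.

(** The factor [c] may be negative, so integrability is needed; it follows from [g] being
    nonnegative with finite integral. *)
Lemma integralZl_EFin d (T : measurableType d) (R : realType)
    (P : {measure set T -> \bar R}) (g : T -> R) (c r : R) :
  measurable_fun [set: T] g -> (forall x, 0 <= g x) ->
  (\int[P]_x (g x)%:E = r%:E)%E -> (\int[P]_x (c * g x)%:E = (c * r)%:E)%E.
Proof.
move=> mg g0 gr; under eq_integral do rewrite EFinM.
rewrite integralZl ?gr//; apply/integrableP; split.
  exact/measurable_EFinP.
under eq_integral do rewrite /= ger0_norm//.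
by rewrite gr ltry.
Qed.

(** For a tail coordinate, the induction hypothesis handles the section and the resulting density is
    averaged over the head. For the head coordinate, the order is reversed. *)
Lemma influence_halfspace (R : realType) (n : nat) (m t : R) (w : Rn R n)
    (k : 'I_n) :
  (\int[gaussian R n]_x
     (\1_[set x | (t < m + dotprod x w)%R] x * coordinate k x)%:E =
   (coordinate k w * normal_pdf m (l2norm w) t)%:E)%E.
Proof.
elim: n m w k => [m w []//|n IH m w k].
have [[a v] ->] := Rn_consP _ _ w.
have int p (z : Rn R p) (j : 'I_p) (l : R) :
    (gaussian R p).-integrable [set: Rn R p]
    (fun x => (\1_[set x | t < l + dotprod x z] x * coordinate j x)%:E).
  apply: integrable_indicM; first exact: measurable_halfspace.
  exact: integrable_coordinate.
have [j ->|->] := unliftP ord0 k.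
- rewrite integral_gaussianS// coordinate_consS.
  transitivity (\int[@normal_prob R 0 1]_x
      (coordinate j v * normal_pdf (m + x * a) (l2norm v) t)%:E)%E.
    apply: eq_integral => x _; rewrite -IH; apply: eq_integral => y _.
    by rewrite coordinate_consS !indic_predE dotprod_cons addrA.
  (* The averaging lemma requires a positive deviation. Here the deviation is 0, but so is
     [coordinate j v], and both sides vanish. *)
  have [v0|v0] := eqVneq (l2norm v) 0.
    rewrite l2norm_eq0// mul0r; apply: integral0_eq => x _.
    by rewrite mul0r.
  have v1 : 0 < l2norm v by rewrite lt_neqAle eq_sym v0 sqrtr_ge0.
  apply: integralZl_EFin.
  + under eq_fun do rewrite normal_pdfC//.
    apply: measurableT_comp; first exact: measurable_normal_pdf.
    by apply: measurable_funD => //; exact: measurable_funM.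
  + by move=> x; exact: normal_pdf_ge0.
  + by rewrite integral_normal_pdf_affine// l2norm_cons addrC.
- rewrite integral_gaussianS_swap// coordinate_cons0.
  transitivity (\int[gaussian R n]_y
      (a * normal_pdf (m + dotprod y v) `|a| t)%:E)%E.
    apply: eq_integral => y _; rewrite -integral_normal_prob_halfline.
    apply: eq_integral => x _.
    by rewrite coordinate_cons0 !indic_predE dotprod_cons addrCA addrC -addrA.
  (* Likewise, the factor [a] annihilates both sides in the degenerate case. *)
  have [->|a0] := eqVneq a 0.
    rewrite mul0r; apply: integral0_eq => x _.
    by rewrite mul0r.
  apply: integralZl_EFin.
  + under eq_fun do rewrite normal_pdfC ?normr_eq0//.
    apply: measurableT_comp; first exact: measurable_normal_pdf.
    by apply: measurable_funD => //; exact: measurable_dotprod.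
  + by move=> x; exact: normal_pdf_ge0.
  + rewrite integral_gaussian_normal_pdf ?normr_gt0//.
    by rewrite real_normK ?num_real// l2norm_cons.
Qed.

(** * The logarithmic factor *)

(** The chain is [pi * 2 <= 8 <= (5 / 4) ^+ 10 <= expR (1 / 4) ^+ 10 = expR (5 / 2)]. *)
Lemma ln_pi2_le (R : realType) : ln (pi * 2) <= 5 / 2 :> R.
Proof.
have pi0 := pi_gt0 R; have pi4 : pi * 2 <= 8 :> R.
  by have := pihalf_lt2 R; lra.
have e14 : 5 / 4 <= expR (1 / 4) :> R.
  by apply: le_trans (expR_ge1Dx _); lra.
rewrite -[leRHS]expRK ler_ln ?posrE ?expR_gt0 ?mulr_gt0//.
apply: (le_trans pi4).
have -> : 5 / 2 = 10%:R * (1 / 4) :> R by lra.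
rewrite expRM_natl.
apply: (@le_trans _ _ ((5 / 4) ^+ 10)); first by rewrite !exprS expr0; lra.
by apply: lerXn2r; rewrite ?nnegrE ?expR_ge0//; lra.
Qed.

Lemma std_normal_pdf_sqr (R : realType) (t : R) :
  normal_pdf 0 1 t ^+ 2 = (expR (t ^+ 2) * (pi * 2))^-1.
Proof.
rewrite std_normal_pdfE exprMn /normal_peak expr1n mul1r exprVn.
rewrite sqr_sqrtr; last first.
  by rewrite mulrn_wge0// pi_ge0.
have te : 2%:R * (- t ^+ 2 / 2) = - t ^+ 2 by field.
by rewrite -expRM_natl te expRN -mulr_natr -invfM mulrC.
Qed.

Lemma ln_std_normal_pdf_sqr (R : realType) (t : R) :
  ln (expR 1 / normal_pdf 0 1 t ^+ 2) = 1 + t ^+ 2 + ln (pi * 2).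
Proof.
rewrite std_normal_pdf_sqr invrK mulrA -expRD lnM ?expRK//.
- by rewrite posrE expR_gt0.
- by rewrite posrE mulr_gt0// pi_gt0.
Qed.

(** * Weights and covariance for a unit vector *)

Lemma mean_indic (R : realType) (n : nat) (A : set (Rn R n)) :
  measurable A -> mean \1_A = fine (gaussian R n A).
Proof. by move=> mA; rewrite /mean unlock integral_indic// setIT. Qed.

Lemma gaussian_unit_halfspace (R : realType) (n : nat) (t : R) (w : Rn R n) :
  l2norm w = 1 ->
  gaussian R n [set x | dotprod x w > t] = normal_prob 0 1 `]t, +oo[.
Proof.
move=> w1; rewrite -w1 -gaussian_halfspace ?w1 ?oner_neq0//.
by congr (gaussian R n _); apply/seteqP; split => x /=; rewrite add0r.
Qed.

Lemma influence_unit_halfspace (R : realType) (n : nat) (t : R) (w : Rn R n)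
    (k : 'I_n) :
  l2norm w = 1 ->
  influence k [set x | dotprod x w > t] = coordinate k w * normal_pdf 0 1 t.
Proof.
move=> w1; rewrite /influence /mean unlock.
rewrite (eq_integral (fun x => (\1_[set x | (t < 0 + dotprod x w)%R] x *
    coordinate k x)%:E)); last first.
  by move=> x _; rewrite !indic_predE add0r.
by rewrite influence_halfspace w1.
Qed.

(** Each summand is the square of a coordinate of [w] times the same product of densities, and these
    squares sum to 1. *)
Lemma W1_unit_halfspace (R : realType) (n : nat) (s t : R) (w : Rn R n) :
  l2norm w = 1 ->
  W1 [set x | dotprod x w > s] [set x | dotprod x w > t] =
  normal_pdf 0 1 s * normal_pdf 0 1 t.
Proof.
move=> w1; rewrite /W1.
under eq_bigr do rewrite !influence_unit_halfspace// mulrACA -expr2.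
rewrite -mulr_suml -[X in X * _](sqr_sqrtr (a := \sum_(i < n) _)).
  by rewrite -/(l2norm w) w1 expr1n mul1r.
by apply: sumr_ge0 => i _; exact: sqr_ge0.
Qed.

(** The complement of the open half-line is closed, and reflection carries it to the closed upper
    tail. *)
Lemma normal_prob_lower_tail (R : realType) (t : R) :
  1 - fine (@normal_prob R 0 1 `]- t, +oo[) =
  fine (@normal_prob R 0 1 `[t, +oo[).
Proof.
rewrite -setCitvl -[X in _ = fine X]normal_probN//.
rewrite (_ : -%R @^-1` _ = `]-oo, - t]%classic); last first.
  by rewrite opp_preimage_itvbndy.
rewrite probability_setC// fineB//.
  by rewrite opprB subrKC.
exact: fin_num_measure.
Qed.

(** As [0 <= t], the first half-space lies in the second, so the covariance is P(A) (1 - P(B)). *)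
Lemma Cov_unit_halfspace (R : realType) (n : nat) (w : Rn R n) (t : R) :
  l2norm w = 1 -> 0 <= t ->
  Cov \1_[set x | dotprod x w > t] \1_[set x | dotprod x w > - t] =
  fine (@normal_prob R 0 1 `]t, +oo[) * fine (@normal_prob R 0 1 `[t, +oo[).
Proof.
move=> w1 t0.
have mH s : measurable [set x | dotprod x w > s].
  by apply: measurable_gt_set; exact: measurable_dotprod.
rewrite /Cov (_ : (fun _ => _) = \1_[set x | dotprod x w > t]); last first.
  apply/funext => x; rewrite !indic_predE.
  case: (ltP t) => tx; rewrite ?mul0r// mul1r (le_lt_trans _ tx)//.
  by rewrite (le_trans _ t0)// oppr_le0.
rewrite !mean_indic// !gaussian_unit_halfspace// -normal_prob_lower_tail.
by rewrite mulrBr mulr1.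
Qed.

Theorem proposition1 (R : realType) (n : nat) (hn : (1 <= n)%N)
    (w : Rn R n) (hw : l2norm w = 1) (t : R) (ht : 1 <= t) :
  let A : set (Rn R n) := [set x | dotprod x w > t] in
  let B : set (Rn R n) := [set x | dotprod x w > - t] in
  (Cov \1_A \1_B <=
    2 * W1 A B /
      (Num.sqrt (ln (expR 1 / W1 A A)) * Num.sqrt (ln (expR 1 / W1 B B))) : Prop).
Proof.
move=> A B; have t0 : 0 <= t by lra.
rewrite Cov_unit_halfspace// !W1_unit_halfspace// std_normal_pdfN -!expr2.
set p := normal_pdf 0 1 t.
have p0 : 0 <= p by exact: normal_pdf_ge0.
rewrite ln_std_normal_pdf_sqr; set L := 1 + _ + _.
have l0 : 0 <= ln (pi * 2) :> R by apply: ln_ge0; have := pi_ge2 R; lra.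
have L0 : 0 < L by rewrite /L; have := sqr_ge0 t; lra.
(* The constant is [9 / 8 = 2 / (4 / 3) ^+ 2], as the tail bound dictates. With
   [L <= 7 / 2 + t ^+ 2] the claim is linear in [t] and [t ^+ 2], both at least 1, and this upper
   bound attains equality at [t = 1]. *)
have LE : L <= 9 / 8 * (1 + t) ^+ 2.
  rewrite /L; have := ln_pi2_le R.
  have : 1 <= t ^+ 2 by rewrite exprn_ege1.
  lra.
(* Both logarithms equal [L], so the denominator is [L] itself. *)
rewrite sqr_sqrtr; last exact: ltW.
have finN D : measurable D -> @normal_prob R 0 1 D \is a fin_num.
  by move=> mD; exact: fin_num_measure.
have tail : fine (@normal_prob R 0 1 `[t, +oo[) <= 4 / 3 * (p / (1 + t)).
  by rewrite -lee_fin fineK ?finN//; exact: normal_prob_tail_le.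
(* The open tail is contained in the closed one, so one bound serves both factors of the
   covariance. *)
apply: (@le_trans _ _ ((4 / 3 * (p / (1 + t))) ^+ 2)).
  rewrite expr2; apply: ler_pM => //; try exact: fine_ge0.
  apply: le_trans tail; apply: fine_le; rewrite ?finN//.
  apply: le_measure; rewrite ?inE//.
  by apply: subset_itvr; rewrite bnd_simp.
have t10 : 0 < 1 + t by lra.
rewrite ler_pdivlMr//.
have -> : 2 * p ^+ 2 = (4 / 3 * (p / (1 + t))) ^+ 2 * (9 / 8 * (1 + t) ^+ 2).
  by field; rewrite gt_eqF.
by rewrite ler_wpM2l// sqr_ge0.
Qed.
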